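(* For any nice F{\o}lner sequence $(F_n)$ in $(\mathbb N,\times)$ there exists an $(F_n)$-normal Liouville number.
   Context: $\mathbb N=\{1,2,\dots\}$. A nice F{\o}lner sequence in $(\mathbb N,\times)$ is a sequence of sets $F_n=\{m\in\mathbb N: m\mid L_n\}$ (all divisors of $L_n$), where the leading parameters $L_n\in\mathbb N$ multiplicatively increase to infinity: $L_n\mid L_{n+1}$ and $L_n\ne L_{n+1}$ for all $n$, and for every $m\in\mathbb N$ there is $n_0$ with $m\mid L_n$ for all $n\ge n_0$. For nonempty finite $K\subset\mathbb N$, $B\in\{0,1\}^K$ and $x\in\{0,1\}^{\mathbb N}$ put $\mathsf N(B,x,F_n)=|\{g\in\mathbb N:(\forall h\in K)\ hg\in F_n\text{ and }x_{hg}=B(h)\}|$. A sequence $x\in\{0,1\}^{\mathbb N}$ is (multiplicatively) $(F_n)$-normal if $\lim_n\frac1{|F_n|}\mathsf N(B,x,F_n)=2^{-|K|}$ for all such $K,B$. A real number in $[0,1]$ is $(F_n)$-normal if it has an $(F_n)$-normal binary expansion, where $(x_n)$ is a binary expansion of $\sum_{n\ge1}x_n2^{-n}$. An irrational number $x$ is a Liouville number if for every natural $k$ there is a rational $\frac pq$ with $|x-\frac pq|<\frac1{q^k}$. *)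

(* Defs.v *)
From mathcomp Require Export all_boot all_order all_algebra finmap.
From mathcomp Require Export all_classical all_reals all_analysis.

Set Implicit Arguments.
Unset Strict Implicit.
Unset Printing Implicit Defensive.

Import Order.TTheory GRing.Theory Num.Theory.
Import numFieldNormedType.Exports.

Local Open Scope classical_set_scope.
Local Open Scope ring_scope.

(* The positive integers {1, 2, ...} are the elements of nat satisfying 0 < m;
   0-1 sequences indexed by them are functions nat -> bool whose value at 0
   is never consulted below. *)

(* Sequences of sets and of leading parameters are indexed from n = 0, which
   only shifts the index of the sequences. *)
Definition leading_parameters (L : nat -> nat) : Prop :=
  [/\ forall n, (0 < L n)%N,
      forall n, (L n %| L n.+1)%N,
      forall n, L n <> L n.+1 &
      forall m, (0 < m)%N -> exists n0, forall n, (n0 <= n)%N -> (m %| L n)%N].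

Definition nice_Folner (F : nat -> set nat) : Prop :=
  exists2 L : nat -> nat, leading_parameters L &
    forall n, F n = [set m | (0 < m)%N /\ (m %| L n)%N].

(* [fset_set] sends infinite sets to fset0, but for F finite and K nonempty
   without 0 the set being counted is finite. *)
Definition count_block (K : {fset nat}) (B : {ffun K -> bool})
    (x : nat -> bool) (F : set nat) : nat :=
  #|` fset_set [set g : nat | (0 < g)%N /\
        forall h : K, F (val h * g)%N /\ x (val h * g)%N = B h] |.

Definition normal_seq (R : realType) (F : nat -> set nat)
    (x : nat -> bool) : Prop :=
  forall (K : {fset nat}) (B : {ffun K -> bool}),
    K != fset0 -> 0%N \notin K ->
    (count_block B x (F n))%:R / #|` fset_set (F n)|%:R
      @[n --> \oo] --> (2^-1 ^+ #|` K| : R).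

Definition binary_expansion (R : realType) (x : nat -> bool) (r : R) : Prop :=
  \sum_(1 <= n < N) (x n)%:R * 2 ^- n @[N --> \oo] --> r.

Definition normal_real (R : realType) (F : nat -> set nat) (r : R) : Prop :=
  0 <= r <= 1 /\
  exists2 x : nat -> bool, binary_expansion x r & normal_seq R F x.

(* The bound 1 < q is the standard one: with q = 1 allowed, the rational
   floor(r)/1 would make every irrational r a Liouville number. *)
Definition Liouville (R : realType) (r : R) : Prop :=
  irrational r /\
  forall k : nat, (0 < k)%N -> exists (p : int) (q : nat),
    (1 < q)%N /\ `|r - p%:~R / q%:R| < 1 / q%:R ^+ k.

(* Main.v *)
Require Import Defs.
From mathcomp Require Import zify ring lra.

(** A Liouville number is obtained from a normal sequence [x] by erasing (setting
    to zero) all digits in a sparse family of long windows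
    [N k < m <= k.+1 * N k].  Truncating the resulting expansion just before
    such a window gives a dyadic rational with denominator [2 ^ N k] and error
    at most [2 ^ - (k.+1 * N k)] (lemma [binary_expansion_dyadic_approx]), which
    yields both irrationality and the Liouville property, because the error is
    not zero: a normal sequence has infinitely many ones.  Two facts make this
    work.

    First, erasing the windows does not destroy normality.  Write
    [L n = 2 ^ e * m] with [m] odd.  A divisor of [L n] is [2 ^ a * d] with
    [a <= e] and [d] dividing [m], and for fixed [d] at most [k.+1] exponents [a]
    put it in the [k]-th window, wherever the window starts.  So the window
    holds a proportion at most [k.+1 / e.+1] of the divisors, and it holds none
    at all as long as [L n <= N k].  As [e] tends to infinity with [n], starting
    the [k]-th window late enough makes the union of all windows negligible
    (lemma [exists_sparse_window_starts]).  The same counting along the powers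
    of a prime shows that [h * g] divides [L n] for almost all divisors [g]
    of [L n], for every fixed [h] (lemma [negligible_shift]); this is the Folner
    property.

    Second, a normal sequence exists.  Put signs in place of digits.  Expanding
    the indicator of a block into products of signs, normality amounts to the
    vanishing, for every nonempty finite set [T], of the mean over the divisors
    [g] of [L n] of the product of the signs at [h * g], [h] in [T] (lemmas
    [uncorrelated_cylinder] and [uncorrelated_normal]).  The digits are chosen
    one at a time, in an order in which the divisors of each [L n] come first.
    When the digit of [t] is chosen, only the boundedly many products whose last
    factor sits at [t] get completed, and each of them is linear in the new sign.
    The sign can therefore be chosen so that a weighted sum, over all [T], of the
    squares of the correlation sums grows by a bounded amount per step: the cross
    term can be made nonpositive.  Each correlation sum over the divisors
    of [L n] is then of the order of the square root of their number (lemmas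
    [greedy_signs] and [exists_small_correlations]). *)

Set Implicit Arguments.
Unset Strict Implicit.
Unset Printing Implicit Defensive.

Import Order.TTheory GRing.Theory Num.Theory.
Import numFieldNormedType.Exports.

Local Open Scope classical_set_scope.
Local Open Scope ring_scope.

(** * Greedy choice of signs *)

Definition pm (R : pzRingType) (b : bool) : R := if b then 1 else -1.

Lemma pm_sqr (R : pzRingType) b : pm R b ^+ 2 = 1.
Proof. by case: b; rewrite /pm ?sqrrN expr1n. Qed.

Lemma normr_pm (R : numDomainType) b : `|pm R b| = 1.
Proof. by case: b; rewrite /pm ?normrN normr1. Qed.

(** If neither value works forever, then both fail at the later of the two
    failure times.  This allows a single digit to serve infinitely many
    correlation sums when every finite family of them can be served. *)
Lemma exists_bool_forall_antitone (P : nat -> bool -> Prop) :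
  (forall m n b, (m <= n)%N -> P n b -> P m b) ->
  (forall n, exists b, P n b) -> exists b, forall n, P n b.
Proof.
move=> anti ex; apply/not_existsP => none.
have /existsNP[m Pm] := none true.
have /existsNP[n Pn] := none false.
have [[] Pb] := ex (maxn m n).
- by apply: Pm; apply: anti Pb; exact: leq_maxl.
- by apply: Pn; apply: anti Pb; exact: leq_maxr.
Qed.

Definition signed_sum (R : pzRingType) (A : nat -> (nat -> bool) -> R)
    (z : nat -> bool) (N : nat) : R := \sum_(i < N) pm R (z i) * A i z.

(** The value at time [N] may depend only on the signs chosen before time [N],
    as for predictable processes. *)
Definition causal (R : Type) (A : nat -> (nat -> bool) -> R) :=
  forall N z z', (forall i, (i < N)%N -> z i = z' i) -> A N z = A N z'.

Lemma signed_sum_causal (R : pzRingType) (A : nat -> (nat -> bool) -> R) :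
  causal A -> causal (fun N z => signed_sum A z N).
Proof.
move=> cA N z z' zz'; apply: eq_bigr => i _.
rewrite zz' //; congr (_ * _); apply: cA => j ji; apply: zz'.
exact: ltn_trans (ltn_ord i).
Qed.

(** After expanding the squares, the sign occurs only in the cross term
    [2 * \sum_c w c * S c * A c], linear in it, so one of the two signs makes
    this term nonpositive. *)
Lemma exists_sign_sum_sqr_le (R : realDomainType) (n : nat) (S A w : nat -> R) :
  exists b, \sum_(c < n) w c * (S c + pm R b * A c) ^+ 2
    <= \sum_(c < n) w c * S c ^+ 2 + \sum_(c < n) w c * A c ^+ 2.
Proof.
pose X := \sum_(c < n) w c * (S c * A c) *+ 2.
exists (X <= 0).
have -> : \sum_(c < n) w c * (S c + pm R (X <= 0) * A c) ^+ 2 =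
    \sum_(c < n) w c * S c ^+ 2 + \sum_(c < n) w c * A c ^+ 2
    + pm R (X <= 0) * X.
  rewrite /X mulr_sumr -!big_split /=; apply: eq_bigr => c _.
  have -> : (S c + pm R (X <= 0) * A c) ^+ 2 = S c ^+ 2
     + pm R (X <= 0) * (S c * A c) *+ 2 + pm R (X <= 0) ^+ 2 * A c ^+ 2 by ring.
  by rewrite pm_sqr; ring.
rewrite gerDl; case: (lerP X 0) => X0; rewrite /pm ?mul1r // mulN1r.
by rewrite oppr_le0 ltW.
Qed.

(** A deterministic counterpart of the orthogonality of martingale increments:
    infinitely many signed sums with bounded causal coefficients can be kept of
    order [sqrt N] simultaneously.  The potential
    [\sum_c w c * signed_sum (A c) z N ^+ 2], with weights decreasing fast enough
    for the increments to sum to at most 1, is kept below [N].  It is handled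
    through its partial sums, so that no infinite sum needs to be formed. *)
Lemma greedy_signs (R : realType) (A : nat -> nat -> (nat -> bool) -> R)
    (a : nat -> R) :
  (forall c, causal (A c)) -> (forall c N z, `|A c N z| <= a c) ->
  exists z, forall c, exists C : R,
    forall N, signed_sum (A c) z N ^+ 2 <= C * N%:R.
Proof.
move=> cA Aa.
pose w c : R := 2^-1 ^+ c.+1 / (1 + a c ^+ 2).
have a1 c : 0 < 1 + a c ^+ 2 by rewrite ltr_pwDl ?sqr_ge0.
have w0 c : 0 < w c by rewrite divr_gt0 // exprn_gt0.
have wA n N z : \sum_(c < n) w c * A c N z ^+ 2 <= 1.
  apply: (@le_trans _ _ (\sum_(c < n) 2^-1 ^+ c.+1)).
    apply: ler_sum => c _; rewrite /w -mulrA ler_piMr ?exprn_ge0 //.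
    rewrite mulrC ler_pdivrMr // mul1r.
    have : A c N z ^+ 2 <= a c ^+ 2.
      by rewrite -real_normK ?num_real // lerXn2r ?nnegrE // (le_trans _ (Aa c N z)).
    by move/le_trans; apply; rewrite lerDr.
  have -> : \sum_(c < n) 2^-1 ^+ c.+1 = 1 - 2^-1 ^+ n :> R.
    elim: n => [|n IH]; first by rewrite big_ord0 expr0 subrr.
    by rewrite big_ord_recr /= IH exprS; field.
  by rewrite gerBl exprn_ge0.
pose Pot n N (S : nat -> R) := \sum_(c < n) w c * S c ^+ 2 <= N%:R.
pose Inv N z := forall n, Pot n N (fun c => signed_sum (A c) z N).
have step (s : nat * (nat -> bool)) : exists b, Inv s.1 s.2 ->
    forall n, Pot n s.1.+1
      (fun c => signed_sum (A c) s.2 s.1 + pm R b * A c s.1 s.2).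
  case: s => N z /=.
  have [inv|ninv] := pselect (Inv N z); last by exists true.
  have [b Hb] : exists b, forall n, Pot n N.+1
      (fun c => signed_sum (A c) z N + pm R b * A c N z).
    apply: exists_bool_forall_antitone => [m n b mn|n].
      apply: le_trans; rewrite -(subnKC mn) big_split_ord /= lerDl.
      by apply: sumr_ge0 => i _; rewrite mulr_ge0 ?sqr_ge0 // ltW.
    have [b Hb] := exists_sign_sum_sqr_le n (fun c => signed_sum (A c) z N)
      (fun c => A c N z) w.
    exists b; apply: le_trans Hb _; rewrite -natr1; apply: lerD (wA _ _ _).
    exact: inv.
  by exists b.
have [next nextP] := choice step.
pose st := fix st N : nat -> bool := if N is N'.+1 then
  fun i => if i == N' then next (N', st N') else st N' i else fun=> false.
pose z i := st i.+1 i.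
have stz N i : (i < N)%N -> st N i = z i.
  elim: N => // N IH; rewrite ltnS leq_eqVlt => /orP[/eqP->//|iN] /=.
  by rewrite (ltn_eqF iN) IH.
have inv N : Inv N z.
  elim: N => [|N IH] n.
    rewrite /Pot big1 // => c _.
    by rewrite /signed_sum big_ord0 expr0n mulr0.
  have -> : (fun c => signed_sum (A c) z N.+1) =
     (fun c => signed_sum (A c) (st N) N + pm R (next (N, st N)) * A c N (st N)).
    apply: funext => c; rewrite {1}/signed_sum big_ord_recr /=.
    congr (_ + _ * _).
    - by apply: (signed_sum_causal (cA c)) => i iN; rewrite stz.
    - by rewrite /z /= eqxx.
    - by apply: cA => i iN; rewrite stz.
  have invst : Inv N (st N).
    move=> m; have := IH m; congr (Pot _ _ _); apply: funext => c.
    by apply: (signed_sum_causal (cA c)) => i iN; rewrite stz.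
  exact: (nextP (N, st N) invst n).
exists z => c; exists (w c)^-1 => N.
rewrite -ler_pdivrMl ?invr_gt0 // invrK; apply: le_trans (inv N c.+1).
rewrite big_ord_recr /= lerDr; apply: sumr_ge0 => i _.
by rewrite mulr_ge0 ?sqr_ge0 // ltW.
Qed.

(** * Negligible families of divisors *)

Lemma perm_divisors_pfactor p e m : prime p -> coprime p m -> (0 < m)%N ->
  perm_eq (divisors (p ^ e * m))
    [seq (p ^ a * d)%N | d <- divisors m, a <- iota 0 e.+1].
Proof.
move=> pp pm m0; have p0 := prime_gt0 pp.
have L0 : (0 < p ^ e * m)%N by rewrite muln_gt0 expn_gt0 p0.
have lgn a d : d \in divisors m -> logn p (p ^ a * d) = a.
  rewrite -dvdn_divisors // => dm.
  rewrite lognM ?expn_gt0 ?p0 ?(dvdn_gt0 m0) //.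
  by rewrite lognX logn_prime // eqxx muln1 logn_coprime ?addn0 //
     (coprime_dvdr dm).
apply: uniq_perm; first exact: divisors_uniq.
  apply: allpairs_uniq => [||x y]; [exact: divisors_uniq|exact: iota_uniq|].
  move=> /allpairsP[[d a] [dm _ ->]] /allpairsP[[d' a'] [dm' _ ->]].
  rewrite /= in dm dm' *; move=> eqs; have := congr1 (logn p) eqs; rewrite !lgn // => aa'.
  move/eqP: eqs; rewrite aa' eqn_pmul2l ?expn_gt0 ?p0 // => /eqP ->.
  by [].
move=> g; rewrite -dvdn_divisors //; apply/idP/allpairsP.
  move=> gL; have g0 := dvdn_gt0 L0 gL.
  have [d pd gE] := pfactor_coprime pp g0.
  exists (d, logn p g); rewrite mem_iota add0n leq0n /= ltnS; split.
  - rewrite -dvdn_divisors // -(Gauss_dvdr _ (n := p ^ e)).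
      by apply: dvdn_trans gL; rewrite gE dvdn_mulr.
    by rewrite coprime_sym coprimeXl.
  - have := dvdn_leq_log p L0 gL; rewrite lognM ?expn_gt0 ?p0 // lognX.
    by rewrite (logn_prime p pp) eqxx muln1 (logn_coprime pm) addn0.
  - by rewrite mulnC.
move=> [[d a] [dm]]; rewrite mem_iota add0n leq0n ltnS /= in dm * => ae ->.
by apply: dvdn_mul; rewrite ?dvdn_exp2l // dvdn_divisors.
Qed.

(** The divisors of [L] are cut into the progressions [d, p * d, p ^ 2 * d, ...],
    with [d] prime to [p], each of length [(logn p L).+1]: if no progression
    contains more than [c] points of [A], then the proportion of [A] among the
    divisors is at most [c / (logn p L).+1], regardless of the part of [L] prime
    to [p]. *)
Lemma count_divisors_fibre p L c (A : pred nat) : prime p -> (0 < L)%N ->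
  (forall d, (0 < d)%N ->
     count (fun a => A (p ^ a * d)%N) (iota 0 (logn p L).+1) <= c)%N ->
  (count A (divisors L) * (logn p L).+1 <= c * size (divisors L))%N.
Proof.
move=> pp L0 Ac; have [m pm LE] := pfactor_coprime pp L0.
have m0 : (0 < m)%N by move: L0; rewrite LE muln_gt0 => /andP[].
have /permP/(_ A) cE := perm_divisors_pfactor (logn p L) pp pm m0.
have /perm_size sE := perm_divisors_pfactor (logn p L) pp pm m0.
rewrite {1 3}LE [(m * _)%N]mulnC cE sE size_allpairs size_iota mulnA leq_mul2r /=.
rewrite count_flatten sumnE !big_map mulnC -sum1_size big_distrl /=.
rewrite !big_seq; apply: leq_sum => d; rewrite mul1n -dvdn_divisors // => dm.
by rewrite count_map; apply: Ac; exact: dvdn_gt0 dm.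
Qed.

(** The proportion of [A n] among the divisors of [L n] tends to zero; the form
    without quotients keeps the counting arguments inside the natural numbers. *)
Definition negligible (L : nat -> nat) (A : nat -> pred nat) := forall M,
  exists n0, forall n, (n0 <= n)%N ->
    (M * count (A n) (divisors (L n)) <= size (divisors (L n)))%N.

Lemma sub_negligible L (A A' : nat -> pred nat) :
  (forall n g, (g %| L n)%N -> A n g -> A' n g) -> (forall n, 0 < L n)%N ->
  negligible L A' -> negligible L A.
Proof.
move=> AA' L0 negA M; have [n0 H] := negA M; exists n0 => n nn.
apply: leq_trans (H n nn); rewrite leq_mul2l; apply/orP; right.
rewrite -!size_filter; apply: uniq_leq_size; first exact/filter_uniq/divisors_uniq.
by move=> g; rewrite !mem_filter => /andP[Ag gD]; rewrite gD AA' ?dvdn_divisors.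
Qed.

Lemma negligibleU L (A A' : nat -> pred nat) : negligible L A -> negligible L A' ->
  negligible L (fun n => predU (A n) (A' n)).
Proof.
move=> nA nA' M; have [n0 H] := nA (2 * M)%N; have [n1 H'] := nA' (2 * M)%N.
exists (maxn n0 n1) => n; rewrite geq_max => /andP[/H {}H /H' {}H'].
have := count_predUI (A n) (A' n) (divisors (L n)); nia.
Qed.

Lemma negligible_has L (T : eqType) (s : seq T) (A : T -> nat -> pred nat) :
  (forall h, h \in s -> negligible L (A h)) ->
  negligible L (fun n g => has (fun h => A h n g) s).
Proof.
elim: s => [|h s IH] sA.
  by move=> M; exists 0%N => n _; rewrite (eq_count (a2 := pred0)) ?count_pred0 ?muln0.
apply: negligibleU; first by apply: sA; rewrite mem_head.
by apply: IH => k ks; apply: sA; rewrite in_cons ks orbT.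
Qed.

Lemma count_has_le (T I : eqType) (A : I -> pred T) (s : seq I) (t : seq T) r :
  (forall k, k \in s -> (count (A k) t <= r)%N) ->
  (count (fun a => has (fun k => A k a) s) t <= size s * r)%N.
Proof.
elim: s => [|k s IH] sr; first by rewrite (eq_count (a2 := pred0)) ?count_pred0.
have Ak := sr k (mem_head _ _).
have {}IH : (count (fun a => has (fun k => A k a) s) t <= size s * r)%N.
  by apply: IH => j js; apply: sr; rewrite in_cons js orbT.
rewrite mulSn; apply: leq_trans (leq_add Ak IH).
by rewrite -count_predUI leq_addr.
Qed.

Section Leading.
Variables (L : nat -> nat) (lL : leading_parameters L).

Lemma leading_gt0 n : (0 < L n)%N. Proof. by case: lL. Qed.

Lemma leading_dvdn m n : (m <= n)%N -> (L m %| L n)%N.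
Proof.
case: lL => _ dvd _ _; elim: n => [|n IH]; first by rewrite leqn0 => /eqP->.
rewrite leq_eqVlt => /orP[/eqP->//|mn]; exact: dvdn_trans (IH mn) (dvd n).
Qed.

Lemma leading_logn p M : prime p ->
  exists n0, forall n, (n0 <= n)%N -> (M <= logn p (L n))%N.
Proof.
move=> pp; case: lL => _ _ _ /(_ (p ^ M)%N).
rewrite expn_gt0 prime_gt0 // => /(_ isT)[n0 H]; exists n0 => n nn.
by rewrite -pfactor_dvdn ?leading_gt0 //; exact: H.
Qed.

(** In each progression [d, p * d, p ^ 2 * d, ...] of divisors of [L n] only the
    last term ceases to divide [L n] when multiplied by [p]. *)
Lemma negligible_shift_prime p : prime p ->
  negligible L (fun n g => ~~ (p * g %| L n)%N).
Proof.
move=> pp M; have [n0 H] := leading_logn M pp; exists n0 => n /H Mp.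
have -> : count (fun g => ~~ (p * g %| L n)%N) (divisors (L n)) =
  count (fun g => (g %| L n)%N && ~~ (p * g %| L n)%N) (divisors (L n)).
  by apply: eq_in_count => g; rewrite -dvdn_divisors ?leading_gt0 // => ->.
set A := (X in count X _); rewrite -[leqRHS]mul1n.
apply: leq_trans _ (@count_divisors_fibre p _ 1 A pp (leading_gt0 n) _).
  by rewrite mulnC leq_mul2l leqW ?orbT.
move=> d d0; set e := logn p (L n).
rewrite -(size_filter _ (iota 0 e.+1)) -[leqRHS]/(size [:: e - logn p d]%N).
apply: uniq_leq_size; first exact/filter_uniq/iota_uniq.
move=> a; rewrite mem_filter inE => /andP[/andP[aL]].
rewrite mulnA -expnS => naL _; apply: contraT => ne.
case/negP: naL; have dL : (d %| L n)%N by apply: dvdn_trans aL; rewrite dvdn_mull.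
have p0 := prime_gt0 pp.
have [d' pd' dE] := pfactor_coprime pp d0.
have la b : logn p (p ^ b * d) = (b + logn p d)%N.
  by rewrite lognM ?expn_gt0 ?p0 // lognX logn_prime // eqxx muln1.
have := dvdn_leq_log p (leading_gt0 n) aL; rewrite la -/e => ae.
(* A divisor whose [p]-adic valuation is not maximal can be multiplied by [p]. *)
rewrite dE mulnCA -expnD Gauss_dvd; last by rewrite coprime_sym coprimeXl.
rewrite pfactor_dvdn ?leading_gt0 // -/e.
apply/andP; split; last by move: ne; rewrite inE => /eqP; lia.
by apply: dvdn_trans dL; rewrite dE dvdn_mulr.
Qed.

(** Multiplication by [h] is injective, so the [g] with [h * g] in [A n] are no
    more numerous than [A n], as long as [h * g] is still a divisor. *)
Lemma negligible_preim h (A : nat -> pred nat) : (0 < h)%N ->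
  negligible L (fun n g => ~~ (h * g %| L n)%N) -> negligible L A ->
  negligible L (fun n g => (h * g %| L n)%N ==> A n (h * g)%N).
Proof.
move=> h0 negh negA.
have negB : negligible L (fun n g => (h * g %| L n)%N && A n (h * g)%N).
  move=> M; have [n0 H] := negA M; exists n0 => n /H; apply: leq_trans.
  rewrite leq_mul2l; apply/orP; right; rewrite -!size_filter.
  rewrite -(size_map (muln h)); apply: uniq_leq_size.
    rewrite map_inj_uniq ?filter_uniq ?divisors_uniq // => x y /eqP.
    by rewrite eqn_pmul2l // => /eqP.
  move=> _ /mapP[g + ->]; rewrite !mem_filter => /andP[/andP[hg ->] _] /=.
  by rewrite -dvdn_divisors ?leading_gt0.
apply: sub_negligible (negligibleU negh negB) => [n g _|]; last exact: leading_gt0.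
by rewrite /= implybE => /orP[->//|A1]; case: (h * g %| L n)%N.
Qed.

(** Induction on [h], removing its smallest prime factor [p]: if [h' * g]
    divides [L n], then for almost all such [g] the number [h' * g] can further
    be multiplied by [p]. *)
Lemma negligible_shift h : (0 < h)%N ->
  negligible L (fun n g => ~~ (h * g %| L n)%N).
Proof.
elim/ltn_ind: h => h IH h0; have [->|h1] := eqVneq h 1%N.
  move=> M; exists 0%N => n _; rewrite (eq_in_count (a2 := pred0)).
    by rewrite count_pred0 muln0.
  by move=> g; rewrite mul1n -dvdn_divisors ?leading_gt0 // => ->.
have pp : prime (pdiv h) by rewrite pdiv_prime //; lia.
pose h' := (h %/ pdiv h)%N.
have hE : h = (pdiv h * h')%N by rewrite mulnC divnK // pdiv_dvd.
have h'0 : (0 < h')%N by rewrite divn_gt0 ?pdiv_gt0 // pdiv_leq.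
have h'h : (h' < h)%N by rewrite ltn_Pdiv // prime_gt1.
have negh' := IH _ h'h h'0.
have := negligible_preim h'0 negh' (negligible_shift_prime pp).
apply: sub_negligible => [n g _|]; last exact: leading_gt0.
by rewrite mulnA -hE => ->; rewrite implybT.
Qed.

Lemma negligible_preim_dilation h (A : nat -> pred nat) : (0 < h)%N -> negligible L A ->
  negligible L (fun n g => ~~ (h * g %| L n)%N || A n (h * g)%N).
Proof.
move=> h0 nA; have := negligible_preim h0 (negligible_shift h0) nA.
apply: sub_negligible => [n g _|]; last exact: leading_gt0.
by rewrite implybE.
Qed.

(** A window whose endpoints have ratio [k] contains at most [k] terms of a
    geometric progression of ratio 2, because [2 ^ j < k] forces [j < k]. *)
Lemma count_pow2_window N k d e : (0 < d)%N ->
  (count (fun a => (N < 2 ^ a * d <= k * N)%N) (iota 0 e) <= k)%N.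
Proof.
move=> d0; pose W a := (N < 2 ^ a * d <= k * N)%N.
rewrite -/(count W _).
have [|noW] := boolP (has W (iota 0 e)); last first.
  by move: noW; rewrite has_count -leqNgt leqn0 => /eqP->.
move=> /hasP[a1 _ Wa1].
have exW : exists a, W a by exists a1.
case: (ex_minnP exW) => a0 Wa0 min.
rewrite -size_filter -[leqRHS](size_iota a0); apply: uniq_leq_size.
  exact/filter_uniq/iota_uniq.
move=> a; rewrite mem_filter mem_iota => /andP[Wa _].
have a0a := min _ Wa; rewrite mem_iota a0a /=.
move: Wa Wa0; rewrite /W -{1 2}(subnKC a0a) expnD => /andP[_ h1] /andP[h2 _].
have : (2 ^ (a - a0) < k)%N.
  have : (2 ^ (a - a0) * N < k * N)%N.
    apply: leq_trans h1; rewrite [(2 ^ a0 * _)%N]mulnC -mulnA.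
    by rewrite ltn_pmul2l ?expn_gt0.
  by rewrite ltn_mul2r => /andP[].
have := ltn_expl (a - a0) (isT : (1 < 2)%N); lia.
Qed.

Definition in_windows (N : nat -> nat) g := exists k, (N k < g <= k.+1 * N k)%N.

(** With [E] the length of the progressions of ratio 2, only windows of index
    below the integer cube root [r] of [E] can meet the divisors of [L n].  They
    take at most [r * r] points from each progression, hence a proportion at most
    [r ^ 2 / E <= 1 / r] of all the divisors. *)
Lemma negligible_windows (N : nat -> nat) :
  (forall k n, (N k < L n)%N -> (k.+1 ^ 3 <= (logn 2 (L n)).+1)%N) ->
  negligible L (fun n g => `[< in_windows N g >]).
Proof.
move=> Nk M; have [n0 H] := leading_logn (M ^ 3) (isT : prime 2).
exists n0 => n /H ME; set E := (logn 2 (L n)).+1.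
have exr : exists r, (r ^ 3 <= E)%N by exists M; rewrite leqW.
have ubr i : (i ^ 3 <= E -> i <= E)%N.
  by apply: leq_trans; rewrite -{1}(expn1 i); case: i => // i; rewrite leq_pexp2l.
case: (ex_maxnP exr ubr) => r rE rmax.
have Mr : (M <= r)%N by apply: rmax; rewrite leqW.
have : (count (fun g => `[< in_windows N g >] && (g <= L n)%N) (divisors (L n)) * E
    <= r * r * size (divisors (L n)))%N.
  apply: count_divisors_fibre; rewrite ?leading_gt0 // => d d0.
  apply: (@leq_trans (count (fun a => has (fun k =>
     (N k < 2 ^ a * d <= k.+1 * N k)%N) (iota 0 r)) (iota 0 E))).
    apply: sub_count => a /andP[/asboolP[k kP] aL]; apply/hasP; exists k => //.
    rewrite mem_iota add0n leq0n; apply: rmax; apply: Nk.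
    by apply: leq_trans aL; case/andP: kP.
  have := @count_has_le _ _ (fun k a => N k < 2 ^ a * d <= k.+1 * N k)%N
    (iota 0 r) (iota 0 E) r; rewrite size_iota; apply.
  move=> k; rewrite mem_iota => /andP[_ kr].
  exact: leq_trans (count_pow2_window _ _ _ d0) kr.
have -> : count (fun g => `[< in_windows N g >] && (g <= L n)%N) (divisors (L n))
   = count (fun g => `[< in_windows N g >]) (divisors (L n)).
  apply: eq_in_count => g; rewrite -dvdn_divisors ?leading_gt0 // => gL.
  by rewrite (dvdn_leq (leading_gt0 n) gL) andbT.
set c := count _ _; set s := size _ => cE.
have crr : (c * r ^ 3 <= r * r * s)%N by apply: leq_trans cE; rewrite leq_mul2l rE orbT.
have r0 : (0 < r)%N by apply: rmax.
apply: (@leq_trans (r * c)%N); first by rewrite leq_mul2r Mr orbT.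
rewrite -(@leq_pmul2l (r * r)) ?muln_gt0 ?r0 //; apply: leq_trans crr.
by apply: eq_leq; rewrite !expnS expn0; ring.
Qed.

Lemma exists_sparse_window_starts : exists N : nat -> nat,
  (forall k, 0 < N k)%N /\ negligible L (fun n g => `[< in_windows N g >]).
Proof.
have /choice[N NP] : forall k, exists N, (0 < N)%N /\
    forall n, (N < L n)%N -> (k.+1 ^ 3 <= (logn 2 (L n)).+1)%N.
  move=> k; have [n0 H] := leading_logn (k.+1 ^ 3) (isT : prime 2).
  exists (L n0); split=> [|n LL]; first exact: leading_gt0.
  rewrite leqW // H // leqNgt; apply/negP => /ltnW /leading_dvdn.
  by move=> /(dvdn_leq (leading_gt0 n0)); rewrite leqNgt LL.
exists N; split=> [k|]; first by case: (NP k).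
by apply: negligible_windows => k n; case: (NP k) => _; apply.
Qed.

End Leading.

(** * A sequence with small correlations *)

Lemma leading_size (L : nat -> nat) : leading_parameters L ->
  forall n, (n < size (divisors (L n)))%N.
Proof.
move=> lL; have L0 := leading_gt0 lL.
elim=> [|n IH]; first by have := divisors_id (L0 0%N); case: divisors.
apply: leq_ltn_trans IH _.
rewrite -(size_rcons _ (L n.+1)).
apply: uniq_leq_size.
  rewrite rcons_uniq divisors_uniq andbT -dvdn_divisors //.
  case: lL => _ dvd neq _; apply/negP => dvd'; apply: (neq n).
  by apply/eqP; rewrite eqn_dvd dvd.
move=> g; rewrite mem_rcons inE -!dvdn_divisors // => /orP[/eqP->//|gL].
exact: dvdn_trans gL (leading_dvdn lL (leqnSn n)).
Qed.

(** The positive integers can be listed so that the divisors of every [L n] form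
    an initial segment: list the divisors of [L 0], then the new divisors of
    [L 1], and so on. *)
Lemma leading_enumeration (L : nat -> nat) : leading_parameters L ->
  exists e : nat -> nat, injective e /\
    forall n, perm_eq (mkseq e (size (divisors (L n)))) (divisors (L n)).
Proof.
move=> lL; have L0 := leading_gt0 lL.
pose s := fix s n := if n is n'.+1 then
  s n' ++ [seq d <- divisors (L n) | d \notin s n'] else divisors (L 0).
have s_uniq n : uniq (s n).
  elim: n => [|n IH]; first exact: divisors_uniq.
  rewrite /= cat_uniq IH filter_uniq ?divisors_uniq // andbT.
  by apply/hasPn => d; rewrite mem_filter => /andP[].
have s_mem n : s n =i divisors (L n).
  elim: n => [|n IH] d //; rewrite /= mem_cat mem_filter IH.
  case dn : (d \in divisors (L n)) => //=; move: dn.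
  rewrite -!dvdn_divisors // => dL; apply/esym/(dvdn_trans dL).
  exact: (leading_dvdn lL (leqnSn n)).
have s_perm n : perm_eq (s n) (divisors (L n)).
  by apply: uniq_perm; rewrite ?divisors_uniq.
have s_size n : (n < size (s n))%N by rewrite (perm_size (s_perm n)) leading_size.
have s_nth m n i : (m <= n)%N -> (i < size (s m))%N ->
    nth 0%N (s n) i = nth 0%N (s m) i.
  move=> mn im; elim: n mn => [|n IH]; first by rewrite leqn0 => /eqP->.
  rewrite leq_eqVlt => /orP[/eqP->//|mn]; rewrite /= nth_cat IH //.
  suff -> : (i < size (s n))%N by [].
  apply: leq_trans im _; apply: uniq_leq_size => // d.
  rewrite !s_mem -!dvdn_divisors // => /dvdn_trans; apply.
  by apply: leading_dvdn; rewrite // -ltnS.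
pose e i := nth 0%N (s i) i.
have eE n i : (i < size (s n))%N -> e i = nth 0%N (s n) i.
  move=> iN; rewrite /e; case: (leqP i n) => [le|/ltnW le].
    by rewrite (s_nth i n).
  by rewrite (s_nth n i).
exists e; split=> [i j|n].
  have lt k : (k <= maxn i j)%N -> (k < size (s (maxn i j)))%N.
    by move/leq_ltn_trans; apply.
  rewrite (eE (maxn i j)) ?lt ?leq_maxl // (eE (maxn i j) j) ?lt ?leq_maxr //.
  move/eqP; rewrite nth_uniq // ?lt ?leq_maxl ?leq_maxr //.
  by move/eqP.
rewrite -(perm_size (s_perm n)); suff -> : mkseq e (size (s n)) = s n by [].
apply: (@eq_from_nth _ 0%N) => [|i]; rewrite size_mkseq // => iN.
by rewrite nth_mkseq // (eE n).
Qed.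

Definition correlation (R : pzRingType) (x : nat -> bool) (T : seq nat)
  (g : nat) : R := \prod_(h <- T) pm R (x (h * g)%N).

Lemma normr_correlation (R : numDomainType) x T g : `|correlation R x T g| = 1.
Proof. by rewrite normr_prod big1_seq // => h _; rewrite normr_pm. Qed.

Lemma exists_argmax_seq (I : eqType) (f : I -> nat) (s : seq I) : s != [::] ->
  exists2 h, h \in s & all (fun k => (f k <= f h)%N) s.
Proof.
elim: s => // h [|k s] IH _; first by exists h; rewrite ?mem_head //= leqnn.
have [m ms /allP mP] := IH isT; case: (leqP (f h) (f m)) => hm.
  exists m; first by rewrite in_cons ms orbT.
  by apply/allP => i; rewrite in_cons => /predU1P[->//|]; exact: mP.
exists h; first exact: mem_head.
apply/allP => i; rewrite in_cons => /predU1P[->//|/mP fi].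
exact: leq_trans fi (ltnW hm).
Qed.

(** The coefficient [A c N] to which the greedy choice is applied collects the
    products attached to the [c]-th finite set [T c] that are completed at time
    [N]: those over [T c * g] where [e N = h * g] for some [h] in [T c] and all the
    other points of [T c * g] have been listed before.  There is at most one for
    each [h], and the remaining factors involve earlier signs only.  Every
    [g] with all of [T c * g] among the divisors of [L n] is counted exactly once,
    at the time when the last point of [T c * g] is listed. *)
Lemma exists_small_correlations (R : realType) (L : nat -> nat) :
  leading_parameters L -> exists x : nat -> bool,
  forall T, uniq T -> T != [::] -> all (leq 1) T -> exists C : R, forall n,
    (\sum_(g <- divisors (L n) | all (fun h => h * g %| L n)%N T)
      correlation R x T g) ^+ 2 <= C * (size (divisors (L n)))%:R.
Proof.
move=> lL; have L0 := leading_gt0 lL; have [e [e_inj e_perm]] := leading_enumeration lL.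
pose d n := size (divisors (L n)).
have e_mem n i : (i < d n)%N -> (e i %| L n)%N.
  move=> id; rewrite dvdn_divisors // -(perm_mem (e_perm n)).
  by apply/mapP; exists i; rewrite // mem_iota.
have e_gt0 i : (0 < e i)%N by apply: dvdn_gt0 (e_mem i i (leading_size lL i)).
have [rank rankP] : exists rank : nat -> nat, forall m, (0 < m)%N -> e (rank m) = m.
  have /choice[rank H] : forall m, exists i, (0 < m)%N -> e i = m.
    move=> m; case: (posnP m) => [->|m0]; first by exists 0%N.
    have [n /(_ n (leqnn n)) mL] : exists n0, forall n, (n0 <= n)%N -> (m %| L n)%N.
      by case: lL => _ _ _; apply.
    move: mL; rewrite dvdn_divisors // -(perm_mem (e_perm n)) => /mapP[i _ ->].
    by exists i.
  by exists rank.
have e_rank i : rank (e i) = i by apply: e_inj; rewrite rankP.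
have rank_lt n m : (0 < m)%N -> (rank m < d n)%N = (m %| L n)%N.
  move=> m0; apply/idP/idP => [/e_mem|mL]; first by rewrite rankP.
  move: mL; rewrite dvdn_divisors // -(perm_mem (e_perm n)) => /mapP[i + ->].
  by rewrite e_rank mem_iota.
(* The code of a list is cleaned so that [T c] is always a set of positive
   integers, as causality needs. *)
pose T c := [seq h <- undup (odflt [::] (choice.unpickle c : option (seq nat))) | (0 < h)%N].
have T_gt0 c h : h \in T c -> (0 < h)%N by rewrite mem_filter => /andP[].
pose A c N z : R := \sum_(h <- T c | (h %| e N)%N &&
    all (fun k => rank (k * (e N %/ h)) <= N)%N (T c))
  \prod_(k <- T c | k != h) pm R (z (rank (k * (e N %/ h))%N)).
have cA c : causal (A c).
  move=> N z z' zz'; apply: eq_bigr => h /andP[hN /allP lastN].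
  rewrite big_seq_cond [RHS]big_seq_cond; apply: eq_bigr => k /andP[kT kh].
  rewrite zz' // ltn_neqAle lastN // andbT; apply: contra kh => /eqP rE.
  have g0 : (0 < e N %/ h)%N by rewrite divn_gt0 ?(dvdn_gt0 _ hN) // dvdn_leq.
  have := rankP (k * (e N %/ h))%N; rewrite muln_gt0 (T_gt0 c) // g0 => /(_ isT).
  by rewrite rE -{1}(divnK hN) mulnC => /eqP; rewrite eqn_pmul2r // eq_sym.
have Aa c N z : `|A c N z| <= (size (T c))%:R.
  apply: le_trans (ler_norm_sum _ _ _) _.
  rewrite (eq_bigr (fun=> 1)) => [|h _]; last first.
    by rewrite normr_prod big1 // => k _; rewrite normr_pm.
  by rewrite big_const_seq iter_addr_0 ler_nat count_size.
have [z zP] := greedy_signs cA Aa.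
exists (z \o rank) => s s_uniq s0 /allP s_gt0.
have [C CP] := zP (choice.pickle s); exists C => n.
have Ts : T (choice.pickle s) = s.
  by rewrite /T choice.pickleK /= undup_id //; apply/all_filterP/allP.
move: (CP (d n)); rewrite -/(d n); congr (_ ^+ 2 <= _).
pose chi g := correlation R (z \o rank) s g.
pose lastin h g := all (fun k => rank (k * g) <= rank (h * g))%N s.
(* Each completed product is restored to a full correlation ... *)
transitivity (\sum_(i < d n) \sum_(h <- s | (h %| e i)%N && lastin h (e i %/ h)%N)
    chi (e i %/ h)%N).
  apply: eq_bigr => i _; rewrite /A Ts mulr_sumr big_seq_cond [RHS]big_seq_cond.
  apply: eq_big => [h|h /andP[hs /andP[hi _]]].
    rewrite /lastin; case hi: (h %| e i)%N; rewrite ?andbF //=.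
    by rewrite [(h * _)%N]mulnC divnK // e_rank.
  rewrite /chi /correlation (bigD1_seq h) //=; congr (pm R (z _) * _).
  by rewrite mulnC divnK // e_rank.
(* ... and, for a fixed [h], indexed by [g] instead of by [h * g]. *)
transitivity (\sum_(h <- s) \sum_(g <- divisors (L n) | (h * g %| L n)%N && lastin h g)
    chi g).
  under eq_bigr do rewrite big_mkcond.
  rewrite exchange_big /=; rewrite !big_seq; apply: eq_bigr => h hs.
  rewrite -big_mkcond /=.
  have h0 := s_gt0 h hs.
  rewrite -(big_mkord (fun i => (h %| e i)%N && lastin h (e i %/ h)%N)
    (fun i => chi (e i %/ h)%N)).
  rewrite /index_iota subn0 -(big_map e (fun t => (h %| t)%N && lastin h (t %/ h)%N)
    (fun t => chi (t %/ h)%N)).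
  rewrite (perm_big _ (e_perm n)) /=.
  rewrite -[LHS]big_filter_cond -[RHS]big_filter_cond.
  have P : perm_eq [seq t <- divisors (L n) | (h %| t)%N]
    [seq (h * g)%N | g <- [seq g <- divisors (L n) | (h * g %| L n)%N]].
    apply: uniq_perm; first by rewrite filter_uniq ?divisors_uniq.
      rewrite map_inj_uniq ?filter_uniq ?divisors_uniq // => x y /eqP.
      by rewrite eqn_pmul2l // => /eqP.
    move=> t; rewrite mem_filter -dvdn_divisors //; apply/andP/mapP.
      move=> [ht tL]; exists (t %/ h)%N; last by rewrite mulnC divnK.
      rewrite mem_filter -dvdn_divisors // [(h * _)%N]mulnC divnK // tL /=.
      by apply: dvdn_trans tL; rewrite -{2}(divnK ht) dvdn_mulr.
    move=> [g + ->]; rewrite mem_filter => /andP[hg _]; split=> //.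
    exact: dvdn_mulr.
  rewrite (perm_big _ P) /= big_map.
  by apply: eq_big => [g|g _]; rewrite mulKn.
under eq_bigr do rewrite big_mkcond.
rewrite exchange_big /= [RHS]big_mkcond /= big_seq [RHS]big_seq.
apply: eq_bigr => g; rewrite -dvdn_divisors // => gL.
have g0 := dvdn_gt0 (L0 n) gL.
have kg0 k : k \in s -> (0 < k * g)%N by move=> ks; rewrite muln_gt0 s_gt0.
(* For a fixed [g] the only contributing [h] is the one for which [h * g] is
   listed last. *)
rewrite -big_mkcond /=; case: ifPn => [/allP sgL|nsgL].
  have [m ms mP] := exists_argmax_seq (fun h => rank (h * g)%N) s0.
  rewrite big_seq_cond (big_rem m) //= ms sgL // /lastin mP /= big1_seq ?addr0 //.
  move=> k /andP[/and3P[ks _ /allP kP] krem]; exfalso.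
  have : rank (k * g)%N = rank (m * g)%N.
    by apply/eqP; rewrite eqn_leq (allP mP) // kP.
  move/(congr1 e); rewrite !rankP ?kg0 // => /eqP; rewrite eqn_pmul2r // => /eqP km.
  by move: krem; rewrite km mem_rem_uniqF.
rewrite big_seq_cond big_pred0 // => h; apply: contraNF nsgL.
case/and3P => hs hgL /allP hP; apply/allP => k ks.
by rewrite -rank_lt ?kg0 // (leq_ltn_trans (hP _ ks)) // rank_lt ?kg0.
Qed.

(** * From vanishing correlations to normality *)

Definition divisor_mean (R : realType) (L : nat -> nat) (f : nat -> nat -> R)
  (n : nat) : R :=
  (\sum_(g <- divisors (L n)) f n g) / (size (divisors (L n)))%:R.

Lemma leading_size_gt0 (R : realType) (L : nat -> nat) : leading_parameters L ->
  forall n, 0 < (size (divisors (L n)))%:R :> R.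
Proof. by move=> lL n; rewrite ltr0n (leq_trans _ (leading_size lL n)). Qed.

Lemma divisor_mean_negligible (R : realType) (L : nat -> nat)
    (A : nat -> pred nat) (f f' : nat -> nat -> R) (l : R) :
  leading_parameters L -> negligible L A ->
  (forall n g, `|f n g| <= 1) -> (forall n g, `|f' n g| <= 1) ->
  (forall n g, (g %| L n)%N -> ~~ A n g -> f n g = f' n g) ->
  divisor_mean L f n @[n --> \oo] --> l -> divisor_mean L f' n @[n --> \oo] --> l.
Proof.
move=> lL negA f1 f'1 ff' fl; have d0 := leading_size_gt0 R lL.
have -> : divisor_mean L f' = fun n => divisor_mean L f n +
    (divisor_mean L f' n - divisor_mean L f n).
  by apply: funext => n; rewrite addrC subrK.
rewrite -[l]addr0; apply: cvgD fl _; apply/cvgr0Pnorm_lt => eps eps0.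
have [M MP] : exists M : nat, 2 / eps < M%:R.
  by exists (Num.bound (2 / eps)); apply: archi_boundP; rewrite divr_ge0 // ltW.
have M0 : 0 < M%:R :> R by apply: lt_trans MP; rewrite divr_gt0.
have [n0 nP] := negA M; exists n0 => // n /= /nP.
rewrite -(ler_nat R) natrM => cM.
rewrite /divisor_mean -mulrBl -sumrB normrM normfV (gtr0_norm (d0 n)).
rewrite ltr_pdivrMr //.
apply: (@le_lt_trans _ _ (2 * (count (A n) (divisors (L n)))%:R)).
  apply: le_trans (ler_norm_sum _ _ _) _.
  apply: (@le_trans _ _ (\sum_(g <- divisors (L n)) 2 * (A n g)%:R)).
    rewrite !big_seq; apply: ler_sum => g; rewrite -dvdn_divisors ?leading_gt0 // => gL.
    case Ag : (A n g); last by rewrite (ff' n g) ?Ag // subrr normr0 mulr0.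
    rewrite mulr1; apply: le_trans (ler_normB _ _) _.
    by rewrite -[2]/(1 + 1) lerD.
  rewrite -mulr_sumr ler_pM2l //; elim: (divisors _) => [|g s IH].
    by rewrite big_nil.
  by rewrite big_cons /= natrD lerD2l.
rewrite ltr_pdivrMr // in MP; rewrite -(ltr_pM2l M0) mulrA [M%:R * 2]mulrC -mulrA.
apply: (@le_lt_trans _ _ (2 * (size (divisors (L n)))%:R)).
  by rewrite ler_pM2l.
by rewrite mulrA ltr_pM2r.
Qed.

(** The bound is of square root order for the sum over those [g] for which all
    the [h * g] divide [L n]; the other [g] are negligible. *)
Lemma divisor_mean_correlation0 (R : realType) (L : nat -> nat) x T (C : R) :
  leading_parameters L -> all (leq 1) T ->
  (forall n, (\sum_(g <- divisors (L n) | all (fun h => h * g %| L n)%N T)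
      correlation R x T g) ^+ 2 <= C * (size (divisors (L n)))%:R) ->
  divisor_mean L (fun=> correlation R x T) n @[n --> \oo] --> 0.
Proof.
move=> lL /allP T0 CP; have d0 := leading_size_gt0 R lL.
pose f n g := if all (fun h => h * g %| L n)%N T then correlation R x T g else 0.
apply: (@divisor_mean_negligible _ _
  (fun n g => has (fun h => ~~ (h * g %| L n)%N) T) f) => //.
- apply: (@negligible_has _ _ T (fun h n g => ~~ (h * g %| L n)%N)) => h hT.
  exact: negligible_shift (T0 _ hT).
- by move=> n g; rewrite /f; case: ifP; rewrite ?normr_correlation ?normr0.
- by move=> n g; rewrite normr_correlation.
- by move=> n g _; rewrite has_predC negbK /f => ->.
apply/cvgr0Pnorm_lt => eps eps0.
near=> n.
rewrite /divisor_mean normrM normfV (gtr0_norm (d0 n)) ltr_pdivrMr //.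
rewrite -(ltr_pXn2r (n := 2)) ?nnegrE ?normr_ge0 ?mulr_ge0 ?(ltW eps0) ?(ltW (d0 n)) //.
rewrite real_normK ?num_real // /f -big_mkcond.
apply: le_lt_trans (CP n) _.
set d := (size _)%:R; rewrite exprMn [d ^+ 2]expr2 mulrA ltr_pM2r ?d0 // mulrC.
rewrite -ltr_pdivrMr ?exprn_gt0 //.
apply: lt_trans (_ : n%:R < _); last by rewrite ltr_nat leading_size.
near: n; apply: (nbhs_infty_gtr (C / eps ^+ 2)).
Unshelve. all: by end_near. Qed.

(** Changing [x] on a negligible set [W] affects the correlation at [g] only if
    some [h * g] falls in [W], which is again rare in [g]. *)
Lemma divisor_mean_correlation_off_negligible (R : realType) (L : nat -> nat)
    (W : pred nat) x T :
  leading_parameters L -> all (leq 1) T -> negligible L (fun=> W) ->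
  divisor_mean L (fun=> correlation R x T) n @[n --> \oo] --> 0 ->
  divisor_mean L (fun=> correlation R (fun m => x m && ~~ W m) T) n
    @[n --> \oo] --> 0.
Proof.
move=> lL /allP T0 negW; apply: (@divisor_mean_negligible _ _
  (fun n g => has (fun h => ~~ (h * g %| L n)%N || W (h * g)%N) T)) => //.
- apply: (@negligible_has _ _ T (fun h n g => ~~ (h * g %| L n)%N || W (h * g)%N)).
  by move=> h /T0 h0; exact: negligible_preim_dilation negW.
- by move=> n g; rewrite normr_correlation.
- by move=> n g; rewrite normr_correlation.
move=> n g _ /hasPn noW; rewrite /correlation !big_seq; apply: eq_bigr => h /noW.
by rewrite negb_or => /andP[_ ->]; rewrite andbT.
Qed.

Definition uncorrelated (R : realType) (L : nat -> nat) (x : nat -> bool) :=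
  forall T, uniq T -> T != [::] -> all (leq 1) T ->
    divisor_mean L (fun=> correlation R x T) n @[n --> \oo] --> 0.

(** The indicator of [x (h * g) = b h] is one half plus a multiple of the sign
    at [h * g], so a block condition can be traded for half of the mean without it
    plus a term with one more sign.  The set [T] of signs already extracted is
    carried along for the induction on [K]; as soon as it is not empty, the
    limit is zero. *)
Lemma uncorrelated_cylinder (R : realType) L x (b : nat -> bool) (K T : seq nat) :
  leading_parameters L -> uncorrelated R L x ->
  uniq (K ++ T) -> all (leq 1) (K ++ T) ->
  divisor_mean L (fun _ g => \prod_(h <- K) (x (h * g)%N == b h)%:R *
     correlation R x T g) n @[n --> \oo] -->
  (if T == [::] then 2^-1 ^+ size K else 0 : R).
Proof.
move=> lL ux; elim: K T => [|h K IH] T.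
  move=> uT T0; have -> : (fun (_ g : nat) => \prod_(h <- [::])
      (x (h * g)%N == b h)%:R * correlation R x T g) = fun=> correlation R x T.
    by apply: funext => _; apply: funext => g; rewrite big_nil mul1r.
  case: eqVneq => [->|T_neq]; last exact: ux.
  rewrite expr0; have -> : divisor_mean L (fun=> correlation R x [::]) = fun=> 1.
    apply: funext => n; rewrite /divisor_mean /correlation.
    under eq_bigr do rewrite big_nil.
    by rewrite big_const_seq iter_addr_0 count_predT divff // gt_eqF // leading_size_gt0.
  exact: cvg_cst.
move=> uhKT hKT0.
have P : perm_eq (K ++ h :: T) ((h :: K) ++ T) by rewrite perm_catC /= perm_cons perm_catC.
have := IH (h :: T); rewrite (perm_uniq P) (perm_all _ P) => /(_ uhKT hKT0) /= cvg1.
have := IH T; move: uhKT hKT0 => /= /andP[_ uKT] /andP[_ KT0] /(_ uKT KT0) cvg2.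
have -> : divisor_mean L (fun _ g => \prod_(h <- h :: K) (x (h * g)%N == b h)%:R *
     correlation R x T g) = (fun n =>
   2^-1 * divisor_mean L (fun _ g => \prod_(h <- K) (x (h * g)%N == b h)%:R *
     correlation R x T g) n + 2^-1 * pm R (b h) *
     divisor_mean L (fun _ g => \prod_(h <- K) (x (h * g)%N == b h)%:R *
     correlation R x (h :: T) g) n).
  apply: funext => n; rewrite /divisor_mean !mulrA -mulrDl; congr (_ / _).
  rewrite !mulr_sumr -big_split /=; apply: eq_bigr => g _.
  rewrite /correlation !big_cons.
  have -> : (x (h * g)%N == b h)%:R =
      2^-1 + 2^-1 * pm R (b h) * pm R (x (h * g)%N) :> R.
    by case: (x _); case: (b _); rewrite /pm /=; lra.
  by ring.
have -> : (if T == [::] then 2^-1 ^+ size (h :: K) else 0) = 2^-1 *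
   (if T == [::] then 2^-1 ^+ size K else 0) + 2^-1 * pm R (b h) * 0 :> R.
  by rewrite mulr0 addr0; case: ifP; rewrite ?mulr0 // exprS.
by apply: cvgD; apply: cvgMr.
Qed.

Lemma card_fset_set_uniq (A : set nat) (s : seq nat) : uniq s ->
  (forall g, A g <-> g \in s) -> #|` fset_set A| = size s.
Proof.
move=> us As; have -> : A = [set` [fset x in s]%fset].
  by apply/seteqP; split=> g /=; rewrite inE => /As.
by rewrite set_fsetK card_fseq undup_id.
Qed.

Lemma natr_all (R : pzSemiRingType) (I : Type) (P : pred I) (s : seq I) :
  (all P s)%:R = \prod_(h <- s) (P h)%:R :> R.
Proof.
elim: s => [|h s IH]; first by rewrite big_nil.
by rewrite big_cons /= -IH; case: (P h); rewrite ?mul1r ?mul0r.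
Qed.

(** The blocks counted by [count_block] have all their positions in [F n], while
    [uncorrelated_cylinder] averages over all divisors of [L n]; the difference
    is negligible. *)
Lemma uncorrelated_normal (R : realType) L (F : nat -> set nat) x :
  leading_parameters L ->
  (forall n, F n = [set m | (0 < m)%N /\ (m %| L n)%N]) ->
  uncorrelated R L x -> normal_seq R F x.
Proof.
move=> lL FE ux K B K_neq0 K0; have L0 := leading_gt0 lL.
pose b h := if insub h is Some k then B k else false.
have bE (h : K) : b (val h) = B h by rewrite /b valK.
have K_gt0 h : h \in enum_fset K -> (0 < h)%N.
  by move=> hK; rewrite lt0n; apply: contra K0 => /eqP <-.
pose P n g := all (fun h => (h * g %| L n)%N && (x (h * g)%N == b h)) (enum_fset K).
have -> : (fun n => (count_block B x (F n))%:R / #|` fset_set (F n)|%:R) =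
    divisor_mean L (fun n g => (P n g)%:R) :> (nat -> R).
  apply: funext => n; rewrite /divisor_mean; congr (_ / _%:R); last first.
    apply: card_fset_set_uniq; first exact: divisors_uniq.
    move=> g; rewrite FE -dvdn_divisors //=; split=> [[]//|gL].
    by split=> //; exact: dvdn_gt0 gL.
  transitivity ((count (P n) (divisors (L n)))%:R : R); last first.
    elim: (divisors _) => [|g s IH]; rewrite ?big_nil // big_cons /= natrD IH //.
  rewrite -size_filter; congr _%:R; apply: card_fset_set_uniq.
    by rewrite filter_uniq ?divisors_uniq.
  move=> g; rewrite mem_filter -dvdn_divisors //=; split.
    move=> [g0 gK]; apply/andP; split.
      apply/allP => h hK; have [] := gK [` hK]%fset; rewrite FE /= => -[_ ->] ->.
      by rewrite -bE eqxx.
    have [h hK] := fset0Pn _ K_neq0.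
    have [] := gK [` hK]%fset; rewrite FE /= => -[_ hgL] _.
    by apply: dvdn_trans hgL; exact: dvdn_mull.
  move=> /andP[/allP gP gL]; have g0 := dvdn_gt0 (L0 n) gL.
  split=> // h; have /andP[hgL /eqP xE] := gP (val h) (valP h).
  by rewrite FE /= muln_gt0 g0 K_gt0 ?(valP h) // xE bE.
have := @uncorrelated_cylinder R L x b (enum_fset K) [::] lL ux.
rewrite cats0 eqxx => /(_ (fset_uniq K)) H.
have {}H := H (introT allP K_gt0).
apply: divisor_mean_negligible H => //.
- apply: (@negligible_has _ _ (enum_fset K) (fun h n g => ~~ (h * g %| L n)%N)).
  by move=> h /K_gt0; exact: negligible_shift.
- move=> n g; rewrite normrM normr_correlation mulr1 -natr_all.
  by case: (all _ _); rewrite ?normr1 ?normr0.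
- by move=> n g; case: (P n g); rewrite ?normr1 ?normr0.
move=> n g _ /hasPn gL; rewrite /P natr_all /correlation big_nil mulr1 !big_seq.
by apply: eq_bigr => h /gL; rewrite negbK => ->.
Qed.

(** Otherwise the mean of the sign of [x] alone would tend to -1. *)
Lemma uncorrelated_infinitely_many_ones (R : realType) L x :
  leading_parameters L -> uncorrelated R L x ->
  forall N, exists m, (N < m)%N && x m.
Proof.
move=> lL ux N; apply/not_existsP => no1; have d0 := leading_size_gt0 R lL.
have H := ux [:: 1%N] isT isT isT.
have : divisor_mean L (fun _ _ => -1 : R) n @[n --> \oo] --> 0.
  apply: (@divisor_mean_negligible _ _ (fun _ g => (g <= N)%N)) H => //.
  - move=> M; exists (M * N)%N => n nn; apply: leq_trans (ltnW (leading_size lL n)).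
    apply: leq_trans nn; rewrite leq_mul2l; apply/orP; right.
    rewrite -size_filter -[leqRHS](size_iota 1); apply: uniq_leq_size.
      by rewrite filter_uniq ?divisors_uniq.
    move=> g; rewrite mem_filter mem_iota add1n ltnS => /andP[gN].
    rewrite -(dvdn_divisors _ (leading_gt0 lL n)) => gL.
    by rewrite (dvdn_gt0 (leading_gt0 lL n) gL).
  - by move=> n g; rewrite normr_correlation.
  - by move=> n g; rewrite normrN normr1.
  move=> n g _; rewrite -ltnNge => Ng; rewrite /correlation big_seq1 mul1n.
  by have := no1 g; rewrite Ng /=; case: (x g).
have -> : divisor_mean L (fun _ _ => -1 : R) = fun=> -1.
  apply: funext => n; rewrite /divisor_mean big_const_seq iter_addr_0 count_predT.
  by rewrite mulNrn mulNr divff // gt_eqF.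
move/(cvg_lim (@Rhausdorff R)); rewrite lim_cst // => /eqP.
by rewrite oppr_eq0 oner_eq0.
Qed.

(** * Liouville numbers from binary expansions *)

Definition binary_sum (R : realType) (x : nat -> bool) (N : nat) : R :=
  \sum_(1 <= n < N) (x n)%:R * 2 ^- n.

Lemma binary_sumS (R : realType) x N :
  binary_sum R x N.+2 = binary_sum R x N.+1 + (x N.+1)%:R * 2 ^- N.+1.
Proof. by rewrite /binary_sum big_nat_recr. Qed.

Lemma binary_sum_le (R : realType) x a b : (a <= b)%N ->
  binary_sum R x a.+1 <= binary_sum R x b.+1 <= binary_sum R x a.+1 + 2 ^- a - 2 ^- b.
Proof.
elim: b => [|b IH]; first by rewrite leqn0 => /eqP->; rewrite addrK lexx.
rewrite leq_eqVlt => /orP[/eqP->|]; first by rewrite addrK lexx.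
rewrite ltnS => /IH /andP[lo hi]; rewrite binary_sumS.
have e0 : 0 < 2 ^- b.+1 :> R by rewrite invr_gt0 exprn_gt0.
have e2 : 2 ^- b = 2 ^- b.+1 + 2 ^- b.+1 :> R.
  rewrite exprS; have ? : 2 ^+ b != 0 :> R by rewrite expf_neq0 ?pnatr_eq0.
  by field.
by case: (x b.+1); rewrite ?mul1r ?mul0r; apply/andP; split; lra.
Qed.

Lemma exists_binary_expansion (R : realType) (x : nat -> bool) :
  exists2 r : R, binary_expansion x r &
    forall a, binary_sum R x a.+1 <= r <= binary_sum R x a.+1 + 2 ^- a.
Proof.
have nd : {homo binary_sum R x : m n / (m <= n)%N >-> m <= n}.
  move=> [|m] [|n] // mn; last by case/andP: (binary_sum_le R x (mn : (m <= n)%N)).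
  have /andP[+ _] := binary_sum_le R x (leq0n n).
  by rewrite [binary_sum R x 1]big_geq // [binary_sum R x 0]big_geq.
have ub a b : binary_sum R x b <= binary_sum R x a.+1 + 2 ^- a.
  apply: (@le_trans _ _ (binary_sum R x (maxn a b).+1)).
    by apply: nd; rewrite leqW // leq_maxr.
  have /andP[_] := binary_sum_le R x (leq_maxl a b).
  by move/le_trans; apply; rewrite gerBl invr_ge0 exprn_ge0.
have cv : cvgn (binary_sum R x).
  apply: nondecreasing_is_cvgn nd _; exists (binary_sum R x 1 + 2 ^- 0) => _ [b _ <-].
  exact: ub.
exists (limn (binary_sum R x)); first exact: cv.
move=> a; rewrite nondecreasing_cvgn_le //=; apply: limr_le cv _.
by apply: nearW => b; exact: ub.
Qed.

Lemma binary_sum_dyadic (R : realType) x N :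
  exists p : nat, binary_sum R x N.+1 = p%:R / 2 ^+ N.
Proof.
elim: N => [|N [p pE]]; first by exists 0%N; rewrite /binary_sum big_geq // mul0r.
exists (p * 2 + x N.+1)%N; rewrite binary_sumS pE natrD natrM exprS.
have ? : 2 ^+ N != 0 :> R by rewrite expf_neq0 ?pnatr_eq0.
by field.
Qed.

Lemma binary_sum_zeros (R : realType) x a b : (a <= b)%N ->
  (forall m, (a < m <= b)%N -> x m = false) ->
  binary_sum R x b.+1 = binary_sum R x a.+1.
Proof.
elim: b => [|b IH]; first by rewrite leqn0 => /eqP->.
rewrite leq_eqVlt => /orP[/eqP->//|]; rewrite ltnS => ab x0.
rewrite binary_sumS x0 ?ltnS ?ab ?leqnn // mul0r addr0; apply: IH => // m /andP[am mb].
by apply: x0; rewrite am leqW.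
Qed.

(** Truncate before a window of zeros: the remainder is not zero because of a
    later one, and it is at most the sum of all [2 ^ - m] with [m] beyond the
    window. *)
Lemma binary_expansion_dyadic_approx (R : realType) x (r : R) :
  (forall a, binary_sum R x a.+1 <= r <= binary_sum R x a.+1 + 2 ^- a) ->
  (forall N, exists m, (N < m)%N && x m) ->
  forall k N, (forall m, (N < m <= k.+1 * N)%N -> x m = false) ->
  exists p : nat, 0 < r - p%:R / 2 ^+ N <= 2 ^- (k.+1 * N).
Proof.
move=> rP ones k N zeros.
have [p pE] := binary_sum_dyadic R x N; exists p; rewrite -pE.
have NkN : (N <= k.+1 * N)%N by rewrite leq_pmull.
apply/andP; split; last first.
  by rewrite lerBlDl -(binary_sum_zeros R NkN zeros); case/andP: (rP (k.+1 * N)%N).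
have [[//|m] /andP[Nm xm]] := ones N; rewrite subr_gt0.
have /andP[+ _] := rP m.+1; apply: lt_le_trans; rewrite binary_sumS xm mul1r.
have /andP[+ _] := binary_sum_le R x (Nm : (N <= m)%N); move/le_lt_trans; apply.
by rewrite ltrDl invr_gt0 exprn_gt0.
Qed.

(** The strict positivity of the errors forces irrationality: a nonzero
    difference between [a / b] and [p / 2 ^ N] is at least [1 / (b * 2 ^ N)], which
    exceeds [2 ^ - (b.+1 * N)] because [b < 2 ^ b]. *)
Lemma Liouville_dyadic_approx (R : realType) (r : R) :
  (forall k, exists2 N, (0 < N)%N &
    exists p : nat, 0 < r - p%:R / 2 ^+ N <= 2 ^- (k.+1 * N)) -> Liouville r.
Proof.
move=> approx; have pow0 n : 0 < 2 ^+ n :> R by rewrite exprn_gt0.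
split.
  move=> /rationalP[a [b rE]]; have [N N0 [p /andP[]]] := approx b.
  have [b0|b0] := posnP b.
    rewrite rE b0 invr0 mulr0 sub0r oppr_gt0.
    by rewrite pmulr_llt0 ?invr_gt0 // ltrn0.
  have bR : 0 < b%:R :> R by rewrite ltr0n.
  have pN0 : 2 ^+ N != 0 :> R by rewrite gt_eqF.
  have bR0 : b%:R != 0 :> R by rewrite gt_eqF.
  have -> : r - p%:R / 2 ^+ N = (a * 2 ^+ N - p%:Z * b%:Z)%:~R / (b%:R * 2 ^+ N).
    by rewrite rE intrB !intrM rmorphXn /= -!pmulrn; field; apply/andP.
  rewrite pmulr_lgt0 ?invr_gt0 ?mulr_gt0 // ltr0z gtz0_ge1 => num1.
  move=> small; have : 1 / (b%:R * 2 ^+ N) <= 2 ^- (b.+1 * N) :> R.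
    apply: le_trans small; rewrite ler_pM2r ?invr_gt0 ?mulr_gt0 //.
    by rewrite -[1]/(1%:~R) ler_int.
  rewrite mul1r lef_pV2 ?posrE ?mulr_gt0 // mulSn exprD mulrC ler_pM2r //.
  rewrite -natrX ler_nat leqNgt => /negP; apply.
  apply: leq_trans (ltn_expl b (isT : (1 < 2)%N)) _.
  by rewrite leq_exp2l // leq_pmulr.
move=> k k0; have [N N0 [p /andP[p1 p2]]] := approx k.
exists p%:Z, (2 ^ N)%N; split; first by rewrite -{1}(expn0 2) ltn_exp2l.
rewrite natrX -pmulrn gtr0_norm //; apply: le_lt_trans p2 _.
rewrite mul1r -exprM ltf_pV2 ?posrE // ltr_eXn2l ?ltr1n //.
by rewrite mulSn mulnC -[X in (X < _)%N]add0n ltn_add2r.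
Qed.

Theorem theorem8p9 (R : realType) (F : nat -> set nat) (hF : nice_Folner F) :
  exists r : R, normal_real F r /\ Liouville r.
Proof.
have [L lL FE] := hF.
have [x xP] := exists_small_correlations R lL.
have [N [N0 negW]] := exists_sparse_window_starts lL.
pose y m := x m && ~~ `[< in_windows N m >].
have uy : uncorrelated R L y.
  move=> T uT T0 Tpos; have [C CP] := xP T uT T0 Tpos.
  apply: (divisor_mean_correlation_off_negligible lL Tpos negW).
  exact: (divisor_mean_correlation0 lL Tpos CP).
have [r yr rP] := exists_binary_expansion R y; exists r; split.
  split; last by exists y => //; exact: (uncorrelated_normal lL FE uy).
  have := rP 0%N; rewrite /binary_sum big_geq // add0r expr0 invr1.
  by [].
apply: Liouville_dyadic_approx => k; exists (N k) => //.
apply: (binary_expansion_dyadic_approx rP).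
  exact: (uncorrelated_infinitely_many_ones lL uy).
move=> m mW; rewrite /y; have -> : `[< in_windows N m >].
  by apply/asboolP; exists k.
by rewrite andbF.
Qed.
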